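(* Let a rational T-spline surface be decomposed by Bézier extraction into finitely many rational Bézier patches $\mathbf{x}^e=\mathbf{F}^e/W^e:[0,1]^2\to\mathbb{R}^3$. If every extracted patch is regular and its corresponding Gram determinant numerator $N^e$ satisfies $N^e(\xi,\eta)>0$ for all $(\xi,\eta)\in[0,1]^2$, then there exists a finite subdivision level such that the sufficient condition for regularity (all Bernstein coefficients of the numerator are nonnegative and at least one is positive) is satisfied on every subdivided subpatch. Consequently, the subdivision-based hierarchical checking procedure terminates after finitely many refinement steps and certifies regularity.
   Context: $B_i^k(t)=\binom{k}{i}t^i(1-t)^{k-i}$, $0\le i\le k$, denote the Bernstein polynomials of degree $k$. T-spline surface and extraction: a rational T-spline surface is $\mathbf{x}(\xi,\eta)=\big(\sum_{i=1}^{n_c} w_iN_i(\xi,\eta)\mathbf{P}_i\big)/\big(\sum_{j=1}^{n_c} w_jN_j(\xi,\eta)\big)$ on a parametric domain $\Omega\subset\mathbb{R}^2$, with control points $\mathbf{P}_i\in\mathbb{R}^3$, weights $w_i>0$, and locally supported T-spline blending functions $N_i$ constructed from local knot vectors given by a T-mesh. $\Omega$ is partitioned into finitely many rectangular elements $e$ on each of which every $N_i$ is a polynomial of bi-degree $(p,q)$. Bézier extraction rewrites, for each $e$ affinely reparametrized to $[0,1]^2$, the restriction of $\mathbf{x}$ as $\mathbf{x}^e=\mathbf{F}^e/W^e$ with $\mathbf{F}^e$ ($\mathbb{R}^3$-valued) and $W^e$ (real-valued) linear combinations of $B_i^p(\xi)B_j^q(\eta)$. The denominators satisfy $W^e>0$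 on $[0,1]^2$. Numerator: with $\mathbf{U}^e=\mathbf{F}^e_\xi W^e-\mathbf{F}^eW^e_\xi$ and $\mathbf{V}^e=\mathbf{F}^e_\eta W^e-\mathbf{F}^eW^e_\eta$, put $N^e=(\mathbf{U}^e\cdot\mathbf{U}^e)(\mathbf{V}^e\cdot\mathbf{V}^e)-(\mathbf{U}^e\cdot\mathbf{V}^e)^2$; then with the Jacobian matrix $J^e=[\mathbf{x}^e_\xi\ \ \mathbf{x}^e_\eta]$ one has $\det((J^e)^\top J^e)=N^e/(W^e)^8$, and $N^e=\sum_{r=0}^{8p-2}\sum_{s=0}^{8q-2}D^e_{rs}B_r^{8p-2}(\xi)B_s^{8q-2}(\eta)$. A patch is regular if $J^e$ has full column rank $2$ on the patch. Subdivision: a patch on $[0,1]^2$ is subdivided at $1/2$ in both parameters into four subpatches; a level-$\ell$ subpatch corresponds to a dyadic square $[a,b]\times[c,d]$ of side $2^{-\ell}$, and its Bernstein coefficients are those (in bi-degree $(8p-2,8q-2)$) of $(\xi,\eta)\mapsto N^e(a+(b-a)\xi,\,c+(d-c)\eta)$. Hierarchical checking procedure: start with the set of all extracted patches at level $k=0$; a maximum refinement level $K_{\max}$ is prescribed. At each level $k$, for every current patch compute its Bernstein coefficients $D_{rs}$; if the four corner coefficients $D_{0,0},D_{8p-2,0},D_{0,8q-2},D_{8p-2,8q-2}$ fail to have the same (nonnegative) sign, stop and return ''Invalid''; otherwise, if all $D_{rs}\ge 0$ and at least one $D_{rs}>0$, the patch is classified as valid; otherwise it is unresolved. If no patch is unresolved,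 return ''Valid''; if some patch is unresolved and $k=K_{\max}$, return ''Undetermined''; otherwise subdivide each unresolved patch into four subpatches, which form the current set for level $k+1$. *)

(* Defs.v *)
From HB Require Import structures.
From mathcomp Require Import all_boot all_order all_algebra.
From mathcomp Require Import boolp classical_sets reals topology normedtype derive.

Set Implicit Arguments.
Unset Strict Implicit.
Unset Printing Implicit Defensive.

Import Order.TTheory GRing.Theory Num.Theory.
Import numFieldNormedType.Exports.

Local Open Scope classical_set_scope.
Local Open Scope ring_scope.

Definition bernstein (R : realType) (k i : nat) (t : R) : R :=
  'C(k, i)%:R * t ^+ i * (1 - t) ^+ (k - i).

Definition bform (R : realType) (m n : nat) (c : 'I_m.+1 -> 'I_n.+1 -> R)
    (x y : R) : R :=
  \sum_(r < m.+1) \sum_(s < n.+1) bernstein m r x * bernstein n s y * c r s.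

Definition bform_vec (R : realType) (m n d : nat)
    (c : 'I_m.+1 -> 'I_n.+1 -> 'cV[R]_d) (x y : R) : 'cV[R]_d :=
  \sum_(r < m.+1) \sum_(s < n.+1) (bernstein m r x * bernstein n s y) *: c r s.

(** The Bernstein coefficients of [f] in bi-degree [(m, n)].  They are unique;
    the value is [0] when [f] is not a polynomial of bi-degree [(m, n)]. *)
Definition bernstein_coefs (R : realType) (m n : nat) (f : R -> R -> R) :
    'M[R]_(m.+1, n.+1) :=
  xget 0 [set D : 'M[R]_(m.+1, n.+1) | forall x y, f x y = bform D x y].

(** An index T-mesh is a partition of [[0, m] x [0, n]] into rectangles with
    integer corners, together with global knots.  The cell [(l, r, b, t)] is
    [[l, r] x [b, t]]; being a partition is expressed by requiring that every
    unit square be covered exactly once. *)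
Definition cell : Type := (nat * nat * nat * nat)%type.
Definition cleft (c : cell) : nat := c.1.1.1.
Definition cright (c : cell) : nat := c.1.1.2.
Definition cbot (c : cell) : nat := c.1.2.
Definition ctop (c : cell) : nat := c.2.

Definition covers (c : cell) (i j : nat) : bool :=
  (cleft c <= i < cright c)%N && (cbot c <= j < ctop c)%N.

Record tmesh (R : realType) := TMesh {
  tm_m : nat;
  tm_n : nat;
  tm_cells : seq cell;
  tm_xi : nat -> R;
  tm_eta : nat -> R;
  tm_cells_in : forall c, c \in tm_cells ->
    (cleft c < cright c <= tm_m)%N && (cbot c < ctop c <= tm_n)%N;
  tm_cells_partition : forall i j, (i < tm_m)%N -> (j < tm_n)%N ->
    count (fun c => covers c i j) tm_cells = 1%N;
  tm_xi_mono : forall i j, (i <= j <= tm_m)%N -> tm_xi i <= tm_xi j;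
  tm_eta_mono : forall i j, (i <= j <= tm_n)%N -> tm_eta i <= tm_eta j }.

Section TMeshTopology.
Variables (R : realType) (M : tmesh R).

(** [vseg i j1 j2]: [{i} x [j1, j2]] lies on a vertical side of a cell. *)
Definition vseg (i j1 j2 : nat) : bool :=
  has (fun c => ((i == cleft c) || (i == cright c)) &&
                (cbot c <= j1)%N && (j2 <= ctop c)%N) (tm_cells M).

Definition hseg (j i1 i2 : nat) : bool :=
  has (fun c => ((j == cbot c) || (j == ctop c)) &&
                (cleft c <= i1)%N && (i2 <= cright c)%N) (tm_cells M).

(** [vskel (j1, j2) i]: [{i} x [j1, j2]] lies in the union of the vertical
    sides; the case [j1 = j2] is that of a point. *)
Definition vskel (b : nat * nat) (i : nat) : bool :=
  if b.1 == b.2 then vseg i b.1 b.1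
  else all (fun j => vseg i j j.+1) (iota b.1 (b.2 - b.1)).

Definition hskel (a : nat * nat) (j : nat) : bool :=
  if a.1 == a.2 then hseg j a.1 a.1
  else all (fun i => hseg j i i.+1) (iota a.1 (a.2 - a.1)).

Definition is_vertex (i j : nat) : bool :=
  has (fun c => ((i == cleft c) || (i == cright c)) &&
                ((j == cbot c) || (j == ctop c))) (tm_cells M).

Definition is_hedge (a : nat * nat) (j : nat) : Prop :=
  [/\ (a.1 < a.2)%N, is_vertex a.1 j, is_vertex a.2 j, hskel a j
    & forall i, (a.1 < i < a.2)%N -> ~~ is_vertex i j].

Definition is_vedge (i : nat) (b : nat * nat) : Prop :=
  [/\ (b.1 < b.2)%N, is_vertex i b.1, is_vertex i b.2, vskel b i
    & forall j, (b.1 < j < b.2)%N -> ~~ is_vertex i j].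

(** Anchors of bi-degree [(p, q)], written as products [a x b] of possibly
    degenerate index intervals: vertices for [p], [q] odd, horizontal edges for
    [p] even and [q] odd, vertical edges for [p] odd and [q] even, cells for
    [p], [q] even. *)
Definition is_anchor (p q : nat) (a b : nat * nat) : Prop :=
  match odd p, odd q with
  | true, true => [/\ a.1 = a.2, b.1 = b.2 & is_vertex a.1 b.1]
  | false, true => b.1 = b.2 /\ is_hedge a b.1
  | true, false => a.1 = a.2 /\ is_vedge a.1 b
  | false, false => (a.1, a.2, b.1, b.2) \in tm_cells M
  end.

(** [I] consists of [p + 2] consecutive elements of [S] with [a] in the middle:
    for [p] odd both middle positions coincide, and so do [a.1] and [a.2]. *)
Definition local_indices (p : nat) (S : nat -> bool) (a : nat * nat)
    (I : seq nat) : Prop :=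
  [/\ size I = p.+2, sorted ltn I, all S I,
      forall i, S i -> (head 0%N I <= i <= last 0%N I)%N -> i \in I
    & nth 0%N I (uphalf p) = a.1 /\ nth 0%N I (p./2.+1) = a.2].

(** The local index vectors read off the mesh by sending rays from an anchor. *)
Definition tmesh_local (p q : nat) (IJ : seq nat * seq nat) : Prop :=
  exists a b : nat * nat,
    [/\ is_anchor p q a b, local_indices p (vskel b) a IJ.1
      & local_indices q (hskel a) b IJ.2].

End TMeshTopology.

(** Cox-de Boor recursion: the B-spline of degree [p] with knots
    [k i, ..., k (i + p + 1)], with the convention [0 / 0 = 0]. *)
Fixpoint bspline (R : realType) (k : nat -> R) (p i : nat) (t : R) : R :=
  match p with
  | 0 => if k i <= t < k i.+1 then 1 else 0
  | p'.+1 =>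
      (t - k i) / (k (i + p)%N - k i) * bspline k p' i t
    + (k (i + p).+1 - t) / (k (i + p).+1 - k i.+1) * bspline k p' i.+1 t
  end.

Record tspline (R : realType) (p q : nat) := TSpline {
  ts_mesh : tmesh R;
  ts_nc : nat;
  ts_loc : 'I_ts_nc -> seq nat * seq nat;
  ts_loc_inj : injective ts_loc;
  ts_locP : forall IJ,
    tmesh_local ts_mesh p q IJ <-> exists i, ts_loc i = IJ;
  ts_weight : 'I_ts_nc -> R;
  ts_weight_gt0 : forall i, 0 < ts_weight i;
  ts_ctrl : 'I_ts_nc -> 'cV[R]_3;
  ts_dom : set (R * R) }.

Section TSplineSurface.
Variables (R : realType) (p q : nat) (T : tspline R p q).

Definition blending (i : 'I_(ts_nc T)) (x y : R) : R :=
  bspline (fun l => tm_xi (ts_mesh T) (nth 0%N (ts_loc i).1 l)) p 0 x *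
  bspline (fun l => tm_eta (ts_mesh T) (nth 0%N (ts_loc i).2 l)) q 0 y.

Definition ts_surface (x y : R) : 'cV[R]_3 :=
  (\sum_j ts_weight j * blending j x y)^-1 *:
  \sum_i (ts_weight i * blending i x y) *: ts_ctrl i.

End TSplineSurface.

(** The elements are [[lo1 e, hi1 e] x [lo2 e, hi2 e]], and [be_op e i] is the
    row of the extraction operator of [e] belonging to the [i]-th blending
    function: the Bernstein coefficients of its restriction to [e].  The
    restriction is taken to the interior because, with repeated knots and the
    right-continuity convention of [bspline], a blending function may differ on
    the boundary of [e] from the polynomial extending it. *)
Record bezier_extraction (R : realType) (p q : nat) (T : tspline R p q) :=
  BezierExtraction {
  be_ne : nat;
  lo1 : 'I_be_ne -> R;
  hi1 : 'I_be_ne -> R;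
  lo2 : 'I_be_ne -> R;
  hi2 : 'I_be_ne -> R;
  be_nondeg : forall e, lo1 e < hi1 e /\ lo2 e < hi2 e;
  be_cover : ts_dom T =
    \bigcup_(e in [set: 'I_be_ne])
      [set z | lo1 e <= z.1 <= hi1 e /\ lo2 e <= z.2 <= hi2 e];
  be_disjoint : forall e e' x y,
    lo1 e < x < hi1 e -> lo2 e < y < hi2 e ->
    lo1 e' < x < hi1 e' -> lo2 e' < y < hi2 e' -> e = e';
  be_op : 'I_be_ne -> 'I_(ts_nc T) -> 'I_p.+1 -> 'I_q.+1 -> R;
  be_opP : forall e i x y, 0 < x < 1 -> 0 < y < 1 ->
    blending i (lo1 e + (hi1 e - lo1 e) * x) (lo2 e + (hi2 e - lo2 e) * y) =
    bform (be_op e i) x y }.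

Section ExtractedPatches.
Variables (R : realType) (p q : nat) (T : tspline R p q).
Variables (X : bezier_extraction T) (e : 'I_(be_ne X)).

Definition patchF : R -> R -> 'cV[R]_3 :=
  bform_vec (fun r s => \sum_i (ts_weight i * be_op e i r s) *: ts_ctrl i).

Definition patchW : R -> R -> R :=
  bform (fun r s => \sum_i ts_weight i * be_op e i r s).

End ExtractedPatches.

Section Gram.
Variable R : realType.

Definition pd1 (V : normedModType R) (f : R -> R -> V) (x y : R) : V :=
  derive1 (fun t => f t y) x.

Definition pd2 (V : normedModType R) (f : R -> R -> V) (x y : R) : V :=
  derive1 (fun t => f x t) y.

Definition dot (u v : 'cV[R]_3) : R := \sum_i u i 0 * v i 0.

Variables (F : R -> R -> 'cV[R]_3) (W : R -> R -> R).

Definition rational_patch (x y : R) : 'cV[R]_3 := (W x y)^-1 *: F x y.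

Definition jacobian (x y : R) : 'M[R]_(3, 1 + 1) :=
  row_mx (pd1 rational_patch x y) (pd2 rational_patch x y).

Definition regular_patch : Prop :=
  forall x y, 0 <= x <= 1 -> 0 <= y <= 1 -> \rank (jacobian x y) = 2%N.

Definition gramU (x y : R) : 'cV[R]_3 :=
  W x y *: pd1 F x y - pd1 W x y *: F x y.

Definition gramV (x y : R) : 'cV[R]_3 :=
  W x y *: pd2 F x y - pd2 W x y *: F x y.

Definition gram_num (x y : R) : R :=
  dot (gramU x y) (gramU x y) * dot (gramV x y) (gramV x y)
  - dot (gramU x y) (gramV x y) ^+ 2.

End Gram.

Lemma patch_restriction (R : realType) (p q : nat) (T : tspline R p q)
    (X : bezier_extraction T) (e : 'I_(be_ne X)) (x y : R) :
  0 < x < 1 -> 0 < y < 1 ->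
  ts_surface T (lo1 e + (hi1 e - lo1 e) * x) (lo2 e + (hi2 e - lo2 e) * y) =
  rational_patch (patchF e) (patchW e) x y.
Proof.
move=> x01 y01; rewrite /ts_surface /rational_patch; congr (_^-1 *: _).
  under eq_bigr do rewrite be_opP// /bform mulr_sumr.
  rewrite exchange_big/=; apply: eq_bigr => r _.
  under eq_bigr do rewrite mulr_sumr.
  rewrite exchange_big/=; apply: eq_bigr => s _.
  by rewrite mulr_sumr; apply: eq_bigr => i _; rewrite mulrCA.
under eq_bigr do rewrite be_opP// /bform mulr_sumr scaler_suml.
rewrite exchange_big/=; apply: eq_bigr => r _.
under eq_bigr do rewrite mulr_sumr scaler_suml.
rewrite exchange_big/=; apply: eq_bigr => s _.
by rewrite scaler_sumr; apply: eq_bigr => i _; rewrite scalerA mulrCA.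
Qed.

(** At level [k], the pair [(i, j)] stands for the dyadic square
    [[i / 2^k, (i + 1) / 2^k] x [j / 2^k, (j + 1) / 2^k]]. *)
Definition subpatch (R : realType) (k : nat) (ij : nat * nat)
    (f : R -> R -> R) (x y : R) : R :=
  f ((ij.1%:R + x) / 2 ^+ k) ((ij.2%:R + y) / 2 ^+ k).

Definition subdivide (ij : nat * nat) : seq (nat * nat) :=
  [:: (ij.1.*2, ij.2.*2); (ij.1.*2.+1, ij.2.*2);
      (ij.1.*2, ij.2.*2.+1); (ij.1.*2.+1, ij.2.*2.+1)].

Definition corners_ge0 (R : realType) (m n : nat) (D : 'M[R]_(m.+1, n.+1)) :=
  [&& 0 <= D ord0 ord0, 0 <= D ord_max ord0,
      0 <= D ord0 ord_max & 0 <= D ord_max ord_max].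

Definition sufficient (R : realType) (m n : nat) (D : 'M[R]_(m.+1, n.+1)) :=
  [forall r, forall s, 0 <= D r s] && [exists r, exists s, 0 < D r s].

Inductive verdict := Valid | Invalid | Undetermined.

Section Procedure.
Variables (R : realType) (p q : nat) (T : tspline R p q).
Variable X : bezier_extraction T.

Definition patch_num (e : 'I_(be_ne X)) : R -> R -> R :=
  gram_num (patchF e) (patchW e).

Definition patch_coefs (k : nat) (P : 'I_(be_ne X) * (nat * nat)) :=
  bernstein_coefs (8 * p - 2)%N (8 * q - 2)%N (subpatch k P.2 (patch_num P.1)).

(** [check n k Ps] starts at level [k] with current patches [Ps] and allows [n]
    further refinements; it returns the verdict and the level at which it is
    reached. *)
Fixpoint check (n k : nat) (Ps : seq ('I_(be_ne X) * (nat * nat))) :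
    verdict * nat :=
  if ~~ all (fun P => corners_ge0 (patch_coefs k P)) Ps then (Invalid, k)
  else
    let unresolved := [seq P <- Ps | ~~ sufficient (patch_coefs k P)] in
    if nilp unresolved then (Valid, k)
    else match n with
         | 0 => (Undetermined, k)
         | n'.+1 =>
             check n' k.+1 [seq (P.1, ij) | P <- unresolved, ij <- subdivide P.2]
         end.

Definition hierarchical_check (Kmax : nat) : verdict * nat :=
  check Kmax 0 [seq (e, (0%N, 0%N)) | e <- enum 'I_(be_ne X)].

End Procedure.

(* Main.v *)
Require Import Defs.
From HB Require Import structures.
From mathcomp Require Import all_boot all_order all_algebra.
From mathcomp Require Import boolp classical_sets reals topology normedtype derive.
From mathcomp Require Import functions realfun zify ring lra.

(** The numerator of the Gram determinant of a rational patch is a polynomial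
    of bi-degree [(8 p - 2, 8 q - 2)]: each component of [U] loses one degree in
    the first variable to the derivative, each component of [V] one in the
    second, and every term of the numerator is a product of two components of
    [U] and two of [V] ([bidegree_gram_num]).  So the numerator and all its restrictions to dyadic
    squares have Bernstein coefficients in that bi-degree, and these are unique
    ([bernstein_coefsE]).

    The regularity certificate rests on a quantitative form of the convergence
    of the control net under subdivision.  Reparametrize a polynomial [f] of
    bi-degree [(m, n)] to the square [[a, a + h] x [b, b + h]] inside the unit
    square.  A monomial [x ^ u y ^ v] becomes
    [(a + h x) ^ u (b + h y) ^ v], whose Bernstein coefficients are products of
    a number in [[a ^ u, (a + h) ^ u]] and one in [[b ^ v, (b + h) ^ v]]
    ([bform1_affine_exp]); they thus differ from [a ^ u b ^ v] by at most
    [(u + v) h].  By linearity every Bernstein coefficient of the restriction of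
    [f] is within [C h] of [f a b], with [C] depending on [f] only
    ([shrunk_bernstein_coefs]).

    If [f] is positive on the closed square then, by compactness, [f >= d > 0]
    there, and all coefficients are positive as soon as [C / 2 ^ k < d]
    ([subpatch_sufficient]).  As there are finitely many patches, the largest of
    the levels so obtained works for all of them.

    The checking procedure cannot answer Invalid, because a corner coefficient
    is the value of the numerator at a corner of the subpatch
    ([subpatch_corners]), and it cannot refine beyond the level just found,
    because no subpatch of that level is unresolved ([check_valid]). *)

Import Order.TTheory GRing.Theory Num.Theory.
Import numFieldNormedType.Exports.
Local Open Scope ring_scope.

Set Implicit Arguments.
Unset Strict Implicit.

(** * Polynomials of bounded bi-degree *)

Section Bidegree.
Context {R : realType}.
Implicit Types (f g : R -> R -> R) (s : seq (R * (nat * nat))).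

Definition mono_eval s (x y : R) : R :=
  \sum_(t <- s) t.1 * (x ^+ t.2.1 * y ^+ t.2.2).

(** Bounding exponents term by term in a list, in which monomials may repeat
    and cancel, makes closure under products and derivatives immediate; the
    bound is only an upper bound on the degrees. *)
Definition bidegree (m n : nat) f : Prop :=
  exists2 s, all (fun t => (t.2.1 <= m)%N && (t.2.2 <= n)%N) s
    & forall x y, f x y = mono_eval s x y.

Lemma bidegree_cst m n c : bidegree m n (fun _ _ => c).
Proof.
exists [:: (c, (0%N, 0%N))] => // x y.
by rewrite /mono_eval big_seq1 !expr0 !mulr1.
Qed.

Lemma bidegree_fst n : bidegree 1 n (fun x _ => x).
Proof.
exists [:: (1, (1%N, 0%N))] => // x y.
by rewrite /mono_eval big_seq1 expr0 mulr1 mul1r.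
Qed.

Lemma bidegree_swap m n f : bidegree m n f -> bidegree n m (fun x y => f y x).
Proof.
move=> [s sP fE]; exists [seq (t.1, (t.2.2, t.2.1)) | t <- s].
  by rewrite all_map; apply: sub_all sP => t /=; rewrite andbC.
move=> x y; rewrite fE /mono_eval big_map.
by apply: eq_bigr => t _ /=; rewrite [x ^+ _ * _]mulrC.
Qed.

Lemma bidegree_le m n m' n' f :
  (m <= m')%N -> (n <= n')%N -> bidegree m n f -> bidegree m' n' f.
Proof.
move=> mm nn [s sP fE]; exists s => //.
apply: sub_all sP => t /andP[tm tn].
by rewrite (leq_trans tm mm) (leq_trans tn nn).
Qed.

Lemma bidegreeD m n f g : bidegree m n f -> bidegree m n g ->
  bidegree m n (fun x y => f x y + g x y).
Proof.
move=> [s sP fE] [s' sP' gE]; exists (s ++ s'); first by rewrite all_cat sP.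
by move=> x y; rewrite fE gE /mono_eval big_cat.
Qed.

Lemma bidegreeM m n m' n' f g : bidegree m n f -> bidegree m' n' g ->
  bidegree (m + m') (n + n') (fun x y => f x y * g x y).
Proof.
move=> [s /allP sP fE] [s' /allP sP' gE].
exists [seq (t.1 * t'.1, ((t.2.1 + t'.2.1)%N, (t.2.2 + t'.2.2)%N))
       | t <- s, t' <- s'].
  apply/allP => _ /allpairsP[[t t'] [/= /sP/andP[? ?] /sP'/andP[? ?] ->]] /=.
  by rewrite !leq_add.
move=> x y; rewrite fE gE /mono_eval big_allpairs_dep mulr_suml.
apply: eq_bigr => t _; rewrite mulr_sumr; apply: eq_bigr => t' _ /=.
by rewrite !exprD; ring.
Qed.

Lemma bidegreeN m n f : bidegree m n f -> bidegree m n (fun x y => - f x y).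
Proof.
move=> /(bidegreeM (bidegree_cst 0 0 (-1)))[s sP fE]; exists s => // x y.
by rewrite -fE mulN1r.
Qed.

Lemma bidegreeX m n k f : bidegree m n f ->
  bidegree (k * m) (k * n) (fun x y => f x y ^+ k).
Proof.
move=> fP; elim: k => [|k IH]; first exact: bidegree_cst.
rewrite !mulSn; have [s sP fE] := bidegreeM fP IH.
by exists s => // x y; rewrite exprS fE.
Qed.

Lemma bidegree_sum (I : Type) (r : seq I) m n (F : I -> R -> R -> R) :
  (forall i, bidegree m n (F i)) ->
  bidegree m n (fun x y => \sum_(i <- r) F i x y).
Proof.
move=> FP; elim: r => [|i r IH].
  have [s sP fE] := bidegree_cst m n 0.
  by exists s => // x y; rewrite big_nil (fE x y).
have [s sP fE] := bidegreeD (FP i) IH.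
by exists s => // x y; rewrite big_cons fE.
Qed.

Lemma bidegree_bernstein k i n : (i <= k)%N ->
  bidegree k n (fun x _ => bernstein k i x).
Proof.
move=> ik; have B1 := bidegreeX i (bidegree_fst 0).
have B2 := bidegreeX (k - i)
  (bidegreeD (bidegree_cst 1 0 1) (bidegreeN (bidegree_fst 0))).
have := bidegreeM (bidegreeM (bidegree_cst 0 0 'C(k, i)%:R) B1) B2.
by apply: bidegree_le; rewrite ?muln0 // add0n !muln1 subnKC.
Qed.

Lemma bidegree_bform m n c : bidegree m n (@bform R m n c).
Proof.
apply: bidegree_sum => r; apply: bidegree_sum => s.
have Br := bidegree_bernstein 0 (ltn_ord r : (r <= m)%N).
have Bs := bidegree_swap (bidegree_bernstein 0 (ltn_ord s : (s <= n)%N)).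
have := bidegreeM (bidegreeM Br Bs) (bidegree_cst 0 0 (c r s)).
by apply: bidegree_le; rewrite !addn0.
Qed.

Lemma is_derive_mono_eval s (x y : R) :
  is_derive x 1 (fun t => mono_eval s t y)
    (mono_eval [seq (t.1 * t.2.1%:R, (t.2.1.-1, t.2.2)) | t <- s] x y).
Proof.
elim: s => [|[c [u v]] s IH].
  have -> : (fun t => mono_eval [::] t y) = cst 0.
    by apply/funext => t; rewrite /mono_eval big_nil.
  by rewrite /mono_eval big_nil; exact: is_derive_cst.
have -> : (fun t => mono_eval ((c, (u, v)) :: s) t y) =
    (c * y ^+ v) *: (id : R -> R) ^+ u + (fun t => mono_eval s t y).
  apply/funext => t; rewrite /mono_eval big_cons /= !fctE.
  by congr (_ + _); rewrite -[_ *: _]/(_ * _); ring.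
apply: is_derive_eq.
rewrite /mono_eval /= big_cons /= scaler1; congr (_ + _).
by rewrite -[_ *: _]/(_ * _); ring.
Qed.

Lemma derivable_bidegree m n f (x y : R) : bidegree m n f ->
  derivable (fun t => f t y) x 1.
Proof.
move=> [s _ fE]; rewrite (_ : (fun t => f t y) = fun t => mono_eval s t y).
  exact: (@ex_derive _ _ _ _ _ _ _ (is_derive_mono_eval s x y)).
by apply/funext => t; rewrite fE.
Qed.

(** With the truncated predecessor this also covers [m = 0], where the
    derivative vanishes. *)
Lemma bidegree_pd1 m n f : bidegree m n f -> bidegree m.-1 n (pd1 f).
Proof.
move=> [s /allP sP fE].
exists [seq (t.1 * t.2.1%:R, (t.2.1.-1, t.2.2)) | t <- s].
  apply/allP => _ /mapP[t /sP/andP[tm tn] ->] /=; rewrite tn andbT.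
  by rewrite -!subn1 leq_sub2r.
move=> x y; rewrite /pd1 derive1E.
rewrite (_ : (fun t => f t y) = fun t => mono_eval s t y).
  exact: (@derive_val _ _ _ _ _ _ _ (is_derive_mono_eval s x y)).
by apply/funext => t; rewrite fE.
Qed.

Definition bidegree_vec d m n (F : R -> R -> 'cV[R]_d) : Prop :=
  forall i, bidegree m n (fun x y => F x y i 0).

Lemma bidegree_bform_vec d m n c : bidegree_vec m n (@bform_vec R m n d c).
Proof.
move=> i; have [s sP fE] := bidegree_bform (fun r k => c r k i 0).
exists s => // x y; rewrite -fE /bform_vec /bform summxE.
by apply: eq_bigr => r _; rewrite summxE; apply: eq_bigr => k _; rewrite mxE.
Qed.

(** The derivative of a vector-valued map is taken in the normed space of
    columns; only for a derivable map is it known to be componentwise. *)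
Lemma pd1_vecE d m n (F : R -> R -> 'cV[R]_d.+1) i (x y : R) :
  bidegree_vec m n F ->
  pd1 F x y i 0 = pd1 (fun x y => F x y i 0) x y.
Proof.
move=> FP; rewrite /pd1 !derive1E derive_mx ?mxE //.
by apply/derivable_mxP => k j; rewrite (ord1 j);
  exact: derivable_bidegree (FP k).
Qed.

Lemma bidegree_gramU m n (F : R -> R -> 'cV[R]_3) W :
  bidegree_vec m n F -> bidegree m n W ->
  bidegree_vec (m.-1 + m) (n + n) (gramU F W).
Proof.
move=> FP WP i.
have /bidegreeM/(_ (bidegree_pd1 (FP i))) := WP.
rewrite addnC => B1.
have [s sP fE] := bidegreeD B1 (bidegreeN (bidegreeM (bidegree_pd1 WP) (FP i))).
exists s => // x y; rewrite -fE /gramU !mxE; congr (_ * _ - _).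
exact: pd1_vecE.
Qed.

(** Exchanging the two variables turns [gramV] into [gramU]. *)
Lemma bidegree_gramV m n (F : R -> R -> 'cV[R]_3) W :
  bidegree_vec m n F -> bidegree m n W ->
  bidegree_vec (m + m) (n.-1 + n) (gramV F W).
Proof.
move=> FP WP i; apply: bidegree_swap.
apply: (@bidegree_gramU n m (fun x y => F y x) (fun x y => W y x)).
  by move=> j; exact: bidegree_swap.
exact: bidegree_swap.
Qed.

Lemma bidegree_dot m n m' n' (U V : R -> R -> 'cV[R]_3) :
  bidegree_vec m n U -> bidegree_vec m' n' V ->
  bidegree (m + m') (n + n') (fun x y => dot (U x y) (V x y)).
Proof. by move=> UP VP; apply: bidegree_sum => i; exact: bidegreeM. Qed.

(** For [p, q > 0] the leading terms of [U] and [V] cancel and the degrees are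
    in fact at most [8 p - 4] and [8 q - 4].  The stated bound comes from
    counting degrees without this cancellation, and for [p = 0] or [q = 0] it agrees with truncated subtraction. *)
Lemma bidegree_gram_num p q (F : R -> R -> 'cV[R]_3) W :
  bidegree_vec p q F -> bidegree p q W ->
  bidegree (8 * p - 2) (8 * q - 2) (gram_num F W).
Proof.
move=> FP WP; have UP := bidegree_gramU FP WP; have VP := bidegree_gramV FP WP.
apply: bidegreeD; last apply: bidegreeN.
  have := bidegreeM (bidegree_dot UP UP) (bidegree_dot VP VP).
  by apply: bidegree_le; lia.
by apply: bidegree_le (bidegreeX 2 (bidegree_dot UP VP)); lia.
Qed.
End Bidegree.

(** * Bernstein coefficients *)

Section Bernstein.
Context {R : realType}.

(** Multiplication by [1 - x] keeps the index and, by [bernstein_recr],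
    multiplication by [x] raises it; the weights that these two ways give to
    [bernstein m.+1 r] are [1 - r / m.+1] and [r / m.+1], which sum to one. *)
Lemma bernstein_recl m r (x : R) : (r <= m)%N ->
  (1 - r%:R / m.+1%:R) * bernstein m.+1 r x = (1 - x) * bernstein m r x.
Proof.
move=> rm; rewrite /bernstein subSn // exprS.
suff H : (1 - r%:R / m.+1%:R) * 'C(m.+1, r)%:R = 'C(m, r)%:R :> R.
  by rewrite -H; ring.
have m0 : m.+1%:R != 0 :> R by rewrite pnatr_eq0.
apply: (mulfI m0); rewrite mulrA mulrBr mulr1 mulrCA divff // mulr1.
by rewrite -natrB ?(leqW rm) // -!natrM -mul_bin_down.
Qed.

Lemma bernstein_recr m r (x : R) :
  r.+1%:R / m.+1%:R * bernstein m.+1 r.+1 x = x * bernstein m r x.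
Proof.
rewrite /bernstein subSS exprS.
suff H : r.+1%:R / m.+1%:R * 'C(m.+1, r.+1)%:R = 'C(m, r)%:R :> R.
  by rewrite -H; ring.
have m0 : m.+1%:R != 0 :> R by rewrite pnatr_eq0.
apply: (mulfI m0); rewrite mulrA mulrCA divff // mulr1.
by rewrite -!natrM mul_bin_diag.
Qed.

Definition bform1 m (c : nat -> R) (x : R) : R :=
  \sum_(r < m.+1) bernstein m r x * c r.

(** The factor takes the values [a] at [0] and [b] at [1].  The new coefficients
    are convex combinations of [a * c r] and [b * c r.-1], which is why the
    bounds simply get multiplied by [a] and [b]. *)
Lemma bform1_mul_affine m c (a b lo hi : R) : 0 <= a <= b -> 0 <= lo ->
  (forall r, lo <= c r <= hi) ->
  exists2 c' : nat -> R, (forall r, a * lo <= c' r <= b * hi)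
    & forall x, (a * (1 - x) + b * x) * bform1 m c x = bform1 m.+1 c' x.
Proof.
move=> /andP[a0 ab] lo0 cP.
(* The cap at [m.+1] keeps the weights in [[0, 1]] for every [r], so that the
   bounds need no restriction on the index. *)
pose w r : R := (minn r m.+1)%:R / m.+1%:R.
have m0 : 0 < m.+1%:R :> R by rewrite ltr0n.
have wE r : (r <= m.+1)%N -> w r = r%:R / m.+1%:R by rewrite /w => /minn_idPl->.
have w01 r : 0 <= w r <= 1.
  by rewrite divr_ge0 //= ler_pdivrMr // mul1r ler_nat geq_minr.
(* Simplification would otherwise unfold the weights. *)
clearbody w.
exists (fun r => (1 - w r) * (a * c r) + w r * (b * c r.-1)).
  move=> r; have /andP[w0 w1] := w01 r.
  have /andP[l1 h1] := cP r; have /andP[l2 h2] := cP r.-1.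
  have hi0 : 0 <= hi by rewrite (le_trans lo0) // (le_trans l1).
  have ca : a * lo <= a * c r <= b * hi.
    by rewrite ler_wpM2l // ler_pM // (le_trans lo0).
  have cb : a * lo <= b * c r.-1 <= b * hi.
    by rewrite ler_pM // ler_wpM2l // (le_trans a0).
  by apply/andP; split; nra.
move=> x; rewrite /bform1.
under [RHS]eq_bigr do rewrite mulrDr.
rewrite big_split /= mulrDl; congr (_ + _).
  rewrite [RHS]big_ord_recr /= wE // divff ?gt_eqF // subrr mul0r mulr0 addr0.
  rewrite mulr_sumr; apply: eq_bigr => r _; rewrite wE ?(ltnW (ltn_ord r)) //.
  transitivity (a * c r * ((1 - x) * bernstein m r x)); first by ring.
  by rewrite -(bernstein_recl x (ltn_ord r : (r <= m)%N)); ring.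
rewrite [RHS]big_ord_recl /= wE // !mul0r mulr0 add0r.
rewrite mulr_sumr; apply: eq_bigr => r _; rewrite /bump /= add1n wE //.
transitivity (b * c r * (x * bernstein m r x)); first by ring.
by rewrite -bernstein_recr; ring.
Qed.

(** The factor is used [u] times; the remaining [m - u] degrees are filled by
    multiplying with [1], the affine function that is [1] at both ends. *)
Lemma bform1_affine_exp m u (a b : R) : 0 <= a <= b -> (u <= m)%N ->
  exists2 c : nat -> R, (forall r, a ^+ u <= c r <= b ^+ u)
    & forall x, (a * (1 - x) + b * x) ^+ u = bform1 m c x.
Proof.
move=> ab; have /andP[a0 aleb] := ab.
elim: m u => [|m IH] u um.
  move: um; rewrite leqn0 => /eqP->; exists (fun=> 1) => [r|x].
    by rewrite !expr0 lexx.
  by rewrite /bform1 big_ord1 /bernstein bin0 !expr0 !mulr1.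
move: um; rewrite leq_eqVlt => /predU1P[->|um].
  have [c cP cE] := IH m (leqnn m).
  have [c' cP' cE'] := bform1_mul_affine m ab (exprn_ge0 m a0) cP.
  by exists c' => [r|x]; rewrite ?exprS // -cE' -cE.
have [c cP cE] := IH u um.
have I : 0 <= (1 : R) <= 1 by rewrite ler01 lexx.
have [c' cP' cE'] := bform1_mul_affine m I (exprn_ge0 u a0) cP.
exists c' => [r|x]; first by have := cP' r; rewrite !mul1r.
by rewrite -cE' -cE; ring.
Qed.

(** The power function is [u]-Lipschitz on [[0, 1]]. *)
Lemma exprD_near (a h : R) u : 0 <= a -> 0 <= h -> a + h <= 1 ->
  (a + h) ^+ u <= a ^+ u + u%:R * h.
Proof.
move=> a0 h0 ah; elim: u => [|u IH]; first by rewrite !expr0 mul0r addr0.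
have au : 0 <= a ^+ u by rewrite exprn_ge0.
have au1 : a ^+ u <= 1 by rewrite exprn_ile1 //; lra.
have uh : 0 <= u%:R * h by rewrite mulr_ge0.
have h1 : (a + h) * (a + h) ^+ u <= (a + h) * (a ^+ u + u%:R * h).
  by rewrite ler_wpM2l // addr_ge0.
have h2 : (a + h) * (u%:R * h) <= u%:R * h by rewrite ler_piMl.
have h3 : h * a ^+ u <= h by rewrite ler_piMr.
by rewrite !exprS -natr1; lra.
Qed.

(** The control net of a restriction shrinks to a point at a rate linear in the
    side of the square, uniformly in its position. *)
Lemma shrunk_bernstein_coefs m n (f : R -> R -> R) : bidegree m n f ->
  exists2 C : R, 0 <= C & forall a b h : R, 0 <= a -> 0 <= b -> 0 <= h ->
    a + h <= 1 -> b + h <= 1 ->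
  exists2 D : 'M[R]_(m.+1, n.+1),
    (forall x y, f (a + h * x) (b + h * y) = bform D x y)
    & forall r s, `|D r s - f a b| <= C * h.
Proof.
move=> [s]; elim: s f => [|[k [u v]] s IH] f /=.
  move=> _ fE; exists 0 => // a b h *; exists 0 => [x y|r l].
    rewrite fE /mono_eval big_nil /bform big1 // => r _.
    by rewrite big1 // => l _; rewrite mxE mulr0.
  by rewrite fE /mono_eval big_nil mxE subrr normr0 mul0r.
move=> /andP[/andP[um vn] sP] fE.
have [C C0 CP] := IH _ sP (fun x y => erefl).
exists (`|k| * (u + v)%:R + C); first by rewrite addr_ge0 // mulr_ge0.
move=> a b h a0 b0 h0 ah bh.
have [D DE DP] := CP a b h a0 b0 h0 ah bh.
have aah : 0 <= a <= a + h by rewrite a0 lerDl.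
have bbh : 0 <= b <= b + h by rewrite b0 lerDl.
have [cu cuP cuE] := bform1_affine_exp aah um.
have [cv cvP cvE] := bform1_affine_exp bbh vn.
exists (\matrix_(r, l) (k * (cu r * cv l) + D r l)) => [x y|r l].
  rewrite fE /mono_eval big_cons -/(mono_eval s _ _) DE /=.
  have -> : a + h * x = a * (1 - x) + (a + h) * x by ring.
  have -> : b + h * y = b * (1 - y) + (b + h) * y by ring.
  rewrite cuE cvE /bform1 /bform mulr_suml mulr_sumr -big_split /=.
  apply: eq_bigr => r _; rewrite !mulr_sumr -big_split /=.
  by apply: eq_bigr => l _; rewrite mxE; ring.
rewrite mxE fE /mono_eval big_cons -/(mono_eval s _ _) /=.
rewrite opprD addrACA -mulrBr mulrDl.
apply: (le_trans (ler_normD _ _)); apply: lerD; last exact: DP.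
rewrite normrM -mulrA ler_wpM2l //.
have /andP[au1 au2] := cuP r; have /andP[bv1 bv2] := cvP l.
have au : 0 <= a ^+ u by rewrite exprn_ge0.
have bv : 0 <= b ^+ v by rewrite exprn_ge0.
have ahu : (a + h) ^+ u <= 1 by rewrite exprn_ile1 ?addr_ge0.
have bhv : (b + h) ^+ v <= 1 by rewrite exprn_ile1 ?addr_ge0.
have eu := exprD_near u a0 h0 ah; have ev := exprD_near v b0 h0 bh.
have u0 : 0 <= u%:R :> R by []. have v0 : 0 <= v%:R :> R by [].
have cul : cu r - a ^+ u <= u%:R * h by lra.
have cvl : cv l - b ^+ v <= v%:R * h by lra.
rewrite natrD ger0_norm; last by rewrite subr_ge0 ler_pM.
(* Change one factor at a time. *)
have -> : cu r * cv l - a ^+ u * b ^+ v =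
  (cu r - a ^+ u) * cv l + a ^+ u * (cv l - b ^+ v) by ring.
rewrite [leRHS]mulrDl lerD //.
  by rewrite (le_trans _ cul) // ler_piMr // ?subr_ge0 //; lra.
by rewrite (le_trans _ cvl) // ler_piMl // ?subr_ge0 //; lra.
Qed.

(** Substituting [x = t / (1 + t)] and multiplying by [(1 + t) ^ m] turns the
    Bernstein basis into the monomials ['C(m, r) t ^ r]; two polynomials in [t]
    that agree at every natural number have the same coefficients. *)
Lemma bform1_inj m (c c' : nat -> R) :
  (forall x, bform1 m c x = bform1 m c' x) ->
  forall r, (r <= m)%N -> c r = c' r.
Proof.
move=> H r rm.
pose P := \poly_(i < m.+1) ('C(m, i)%:R * (c i - c' i)).
have P0 : P = 0.
  apply/eqP/negP => /negP Pn0.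
  pose rs : seq R := [seq i%:R | i <- iota 0 (size P)].
  have U : uniq rs by rewrite map_inj_uniq ?iota_uniq //;
    exact: mulrIn (oner_neq0 _).
  suff A : all (root P) rs.
    by have := max_poly_roots Pn0 A U; rewrite size_map size_iota ltnn.
  apply/allP => _ /mapP[i _ ->]; apply/rootP.
  have i0 : 1 + i%:R != 0 :> R by rewrite nat1r pnatr_eq0.
  have := H (i%:R / (1 + i%:R)); rewrite /bform1.
  pose z : R := i%:R / (1 + i%:R); rewrite -/z.
  have zE : 1 - z = (1 + i%:R)^-1 by rewrite /z; field.
  have E d : \sum_(r < m.+1) bernstein m r z * d r =
    (1 + i%:R) ^- m * \sum_(r < m.+1) 'C(m, r)%:R * d r * i%:R ^+ r.
    rewrite mulr_sumr; apply: eq_bigr => j _; rewrite /bernstein zE.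
    have -> : (1 + i%:R : R) ^- m = (1 + i%:R) ^- j * (1 + i%:R) ^- (m - j).
      by rewrite -invfM -exprD subnKC // -ltnS.
    by rewrite expr_div_n exprVn; ring.
  rewrite !E => /mulfI Heq.
  rewrite horner_poly; apply/eqP.
  under eq_bigr do rewrite mulrBr mulrBl.
  by rewrite sumrB subr_eq0; apply/eqP/Heq; rewrite invr_eq0 expf_neq0.
have := congr1 (fun p : {poly R} => p`_r) P0.
rewrite coef_poly ltnS rm coef0 => /eqP.
by rewrite mulf_eq0 pnatr_eq0 -leqn0 leqNgt bin_gt0 rm /= subr_eq0 => /eqP.
Qed.

Lemma bform_inj m n (D D' : 'M[R]_(m.+1, n.+1)) :
  (forall x y, bform D x y = bform D' x y) -> D = D'.
Proof.
move=> H; apply/matrixP => r s.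
have E (A : 'M[R]_(m.+1, n.+1)) x y : bform A x y =
    bform1 m (fun i => bform1 n (fun j => A (inord i) (inord j)) y) x.
  rewrite /bform /bform1; apply: eq_bigr => i _; rewrite mulr_sumr.
  by apply: eq_bigr => j _; rewrite !inord_val mulrA.
have /(_ r s) : forall i j : nat, (i <= m)%N -> (j <= n)%N ->
    D (inord i) (inord j) = D' (inord i) (inord j).
  move=> i j im; apply: (@bform1_inj n (fun j => D _ (inord j))
    (fun j => D' _ (inord j))) => y; move: i im.
  apply: (@bform1_inj m (fun i => bform1 n (fun j => D (inord i) (inord j)) y)
     (fun i => bform1 n (fun j => D' (inord i) (inord j)) y)) => x.
  by rewrite -!E.
by rewrite !inord_val; apply; rewrite -ltnS.
Qed.

Lemma bernstein_coefsE m n f (D : 'M[R]_(m.+1, n.+1)) :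
  (forall x y, f x y = bform D x y) -> bernstein_coefs m n f = D.
Proof.
move=> fE; apply: xget_unique => // D' D'E; apply: bform_inj => x y.
by rewrite -D'E fE.
Qed.

Lemma bernstein_at0 m (r : 'I_m.+1) : bernstein m r 0 = (r == ord0)%:R :> R.
Proof.
rewrite /bernstein subr0 expr1n mulr1 expr0n.
by rewrite -val_eqE /=; case: (val r) => [|k] /=; rewrite ?bin0 ?mulr1 ?mulr0.
Qed.

Lemma bernstein_at1 m (r : 'I_m.+1) : bernstein m r 1 = (r == ord_max)%:R :> R.
Proof.
rewrite /bernstein subrr expr1n mulr1 expr0n subn_eq0 -val_eqE /=.
have [mr|rm] := leqP m r.
  have -> : val r = m by apply/eqP; rewrite eqn_leq mr -ltnS ltn_ord.
  by rewrite binn eqxx mulr1.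
by rewrite mulr0 ltn_eqF.
Qed.

Lemma bform_corner m n (D : 'M[R]_(m.+1, n.+1)) (x y : R)
    (r0 : 'I_m.+1) (s0 : 'I_n.+1) :
  (forall r : 'I_m.+1, bernstein m r x = (r == r0)%:R) ->
  (forall s : 'I_n.+1, bernstein n s y = (s == s0)%:R) -> bform D x y = D r0 s0.
Proof.
move=> xE yE; rewrite /bform (bigD1 r0) //= [X in _ + X]big1; last first.
  by move=> r /negPf rr; rewrite big1 // => s _; rewrite xE rr !mul0r.
rewrite addr0 (bigD1 s0) //= big1; last first.
  by move=> s /negPf ss; rewrite yE ss mulr0 mul0r.
by rewrite addr0 xE yE !eqxx !mul1r.
Qed.
End Bernstein.

(** * Positivity after subdivision *)

Section Subdivision.
Context {R : realType}.
Implicit Types f : R -> R -> R.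

Definition pos_on_square f : Prop :=
  forall x y, 0 <= x <= 1 -> 0 <= y <= 1 -> 0 < f x y.

Lemma continuous_bidegree m n f : bidegree m n f ->
  continuous (fun z : R * R => f z.1 z.2).
Proof.
move=> [s _ fE].
have -> : (fun z : R * R => f z.1 z.2) = fun z => mono_eval s z.1 z.2.
  by apply/funext => z; rewrite fE.
elim: s {fE} => [|t s IH].
  have -> : (fun z : R * R => mono_eval [::] z.1 z.2) = fun=> 0.
    by apply/funext => z; rewrite /mono_eval big_nil.
  exact: cst_continuous.
have -> : (fun z : R * R => mono_eval (t :: s) z.1 z.2) =
    fun z => t.1 * (z.1 ^+ t.2.1 * z.2 ^+ t.2.2) + mono_eval s z.1 z.2.
  by apply/funext => z; rewrite /mono_eval big_cons.
move=> z; apply: (@continuousD _ _ _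
    (fun z : R * R => t.1 * (z.1 ^+ t.2.1 * z.2 ^+ t.2.2))
    (fun z => mono_eval s z.1 z.2)); last exact: IH.
apply: continuousM; first exact: cst_continuous.
apply: continuousM.
  by apply: (@continuous_comp _ _ _ fst (fun x : R => x ^+ t.2.1));
    [exact: cvg_fst|exact: exprn_continuous].
by apply: (@continuous_comp _ _ _ snd (fun y : R => y ^+ t.2.2));
  [exact: cvg_snd|exact: exprn_continuous].
Qed.

Lemma bidegree_lower_bound m n f : bidegree m n f -> pos_on_square f ->
  exists2 d : R, 0 < d & forall x y, 0 <= x <= 1 -> 0 <= y <= 1 -> d <= f x y.
Proof.
move=> fP f0; pose I : set R := `[0, 1]%classic.
have I0 : I 0 by rewrite /I /= in_itv /= lexx ler01.
have [|||z Iz zmin] := @compact_EVT_min _ R (fun z : R * R => f z.1 z.2)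
    (I `*` I)%classic.
- by exists (0, 0).
- by apply: compact_setX; exact: segment_compact.
- exact/continuous_subspaceT/(continuous_bidegree fP).
exists (f z.1 z.2).
  by move: Iz; rewrite inE => -[]; rewrite /I /= !in_itv /=; exact: f0.
move=> x y x01 y01; apply: (zmin (x, y)).
by rewrite inE; split; rewrite /I /= in_itv.
Qed.

Lemma dyadic_square k i : (i < 2 ^ k)%N ->
  0 <= i%:R / 2 ^+ k :> R /\ i%:R / 2 ^+ k + 2 ^- k <= 1 :> R.
Proof.
move=> ik; split; first by rewrite divr_ge0 // exprn_ge0.
rewrite -[X in _ + X]mul1r -mulrDl ler_pdivrMr ?exprn_gt0 // mul1r natr1.
by rewrite -natrX ler_nat.
Qed.

Lemma subpatchE k ij f (x y : R) : subpatch k ij f x y =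
  f (ij.1%:R / 2 ^+ k + 2 ^- k * x) (ij.2%:R / 2 ^+ k + 2 ^- k * y).
Proof. by rewrite /subpatch !mulrDl ![2 ^- k * _]mulrC. Qed.

(** At a corner of the square all but one of the Bernstein polynomials vanish,
    so the corner coefficients are values of [f] at the corners. *)
Lemma subpatch_corners m n f k (ij : nat * nat) :
  bidegree m n f -> pos_on_square f -> (ij.1 < 2 ^ k)%N -> (ij.2 < 2 ^ k)%N ->
  corners_ge0 (bernstein_coefs m n (subpatch k ij f)).
Proof.
move=> fP f0 ik jk; have [C _ CP] := shrunk_bernstein_coefs fP.
have [a0 ah] := dyadic_square ik; have [b0 bh] := dyadic_square jk.
have h0 : 0 <= 2 ^- k :> R by rewrite invr_ge0 exprn_ge0.
have [D DE _] := CP _ _ _ a0 b0 h0 ah bh.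
rewrite (bernstein_coefsE (D := D)) => [|x y]; last by rewrite subpatchE.
have pos x y : 0 <= x <= 1 -> 0 <= y <= 1 -> 0 <= bform D x y.
  move=> /andP[x0 x1] /andP[y0 y1]; rewrite -DE ltW //; apply: f0; nra.
have I0 : 0 <= (0 : R) <= 1 by rewrite lexx ler01.
have I1 : 0 <= (1 : R) <= 1 by rewrite lexx ler01.
pose z k r := @bernstein_at0 R k r; pose o k r := @bernstein_at1 R k r.
rewrite /corners_ge0 -(bform_corner D (z m) (z n)).
rewrite -(bform_corner D (o m) (z n)) -(bform_corner D (z m) (o n)).
by rewrite -(bform_corner D (o m) (o n)) !pos.
Qed.

Lemma subpatch_sufficient m n f : bidegree m n f -> pos_on_square f ->
  exists l0, forall k (ij : nat * nat), (l0 <= k)%N ->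
    (ij.1 < 2 ^ k)%N -> (ij.2 < 2 ^ k)%N ->
    sufficient (bernstein_coefs m n (subpatch k ij f)).
Proof.
move=> fP f0; have [C C0 CP] := shrunk_bernstein_coefs fP.
have [d d0 dP] := bidegree_lower_bound fP f0.
(* [2 ^ k > k >= l0 > C / d]. *)
pose l0 := Num.bound (C / d); exists l0 => k ij lk ik jk.
have [a0 ah] := dyadic_square ik; have [b0 bh] := dyadic_square jk.
have h0 : 0 < 2 ^- k :> R by rewrite invr_gt0 exprn_gt0.
have [D DE DP] := CP _ _ _ a0 b0 (ltW h0) ah bh.
rewrite (bernstein_coefsE (D := D)) => [|x y]; last by rewrite subpatchE.
have Chd : C * 2 ^- k < d.
  rewrite ltr_pdivrMr ?exprn_gt0 // -ltr_pdivrMl // mulrC.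
  apply: (lt_le_trans (archi_boundP _)); first by rewrite divr_ge0 // ltW.
  by rewrite -natrX ler_nat (leq_trans lk) // ltnW // ltn_expl.
have Dpos r s : 0 < D r s.
  have := DP r s; rewrite ler_norml => /andP[lo _].
  suff : d <= f (ij.1%:R / 2 ^+ k) (ij.2%:R / 2 ^+ k) by lra.
  by apply: dP; lra.
apply/andP; split; first by apply/forallP => r; apply/forallP => s; exact: ltW.
by apply/existsP; exists ord0; apply/existsP; exists ord0.
Qed.

End Subdivision.

(** * The checking procedure *)

Section Check.
Variables (R : realType) (p q : nat) (T : tspline R p q).
Variable X : bezier_extraction T.

Definition dyadic_patch (k : nat) (P : 'I_(be_ne X) * (nat * nat)) : bool :=
  (P.2.1 < 2 ^ k)%N && (P.2.2 < 2 ^ k)%N.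

Lemma dyadic_subdivide k P ij :
  dyadic_patch k P -> ij \in subdivide P.2 -> dyadic_patch k.+1 (P.1, ij).
Proof.
move=> /andP[Pi Pj]; rewrite !inE /dyadic_patch expnS.
by move=> /or4P[] /eqP-> /=; apply/andP; split; lia.
Qed.

Lemma all_dyadic_subdivide k (Ps : seq ('I_(be_ne X) * (nat * nat))) :
  all (dyadic_patch k) Ps ->
  all (dyadic_patch k.+1) [seq (P.1, ij) | P <- Ps, ij <- subdivide P.2].
Proof.
move=> /allP PsP; apply/allP => Q /allpairsPdep[P [ij [/PsP PP ijP ->]]].
exact: dyadic_subdivide.
Qed.

(** The hypotheses exclude the answer Invalid at every level, and leave nothing
    unresolved at level [l]; the bound [l <= k + n] says that enough refinements
    remain to reach that level. *)
Lemma check_valid l n k Ps :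
  (forall k P, dyadic_patch k P -> corners_ge0 (patch_coefs k P)) ->
  (forall P, dyadic_patch l P -> sufficient (patch_coefs l P)) ->
  (k <= l <= k + n)%N -> all (dyadic_patch k) Ps ->
  exists2 k', (k' <= l)%N & check n k Ps = (Valid, k').
Proof.
move=> corners suff_l.
elim: n k Ps => [|n IH] k Ps /andP[kl ln] PsP /=;
  rewrite (sub_all (corners k) PsP) /=.
  have -> : [seq P <- Ps | ~~ sufficient (patch_coefs k P)] = [::].
    apply/eqP; rewrite -[_ == _]negbK -has_filter -all_predC.
    apply: sub_all PsP => P /=; rewrite negbK.
    have -> : k = l by lia.
    exact: suff_l.
  by exists k.
case: ifP => [_|un]; first by exists k.
apply: IH.
  rewrite addSnnS ln andbT ltn_neqAle kl andbT; apply: contraFN un => /eqP kE.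
  rewrite /nilp size_eq0 -[_ == _]negbK -has_filter -all_predC.
  apply: sub_all PsP => P /=; rewrite negbK kE; exact: suff_l.
apply: (@all_dyadic_subdivide _
  [seq P <- Ps | ~~ sufficient (patch_coefs k P)]).
by rewrite all_filter; apply: sub_all PsP => P PP /=; apply/implyP.
Qed.

End Check.

Theorem corollary3p10 (R : realType) (p q : nat) (T : tspline R p q)
    (X : bezier_extraction T)
    (W_gt0 : forall (e : 'I_(be_ne X)) (x y : R),
       0 <= x <= 1 -> 0 <= y <= 1 -> 0 < patchW e x y)
    (regular : forall e : 'I_(be_ne X), regular_patch (patchF e) (patchW e))
    (N_gt0 : forall (e : 'I_(be_ne X)) (x y : R),
       0 <= x <= 1 -> 0 <= y <= 1 -> 0 < gram_num (patchF e) (patchW e) x y) :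
  exists l : nat,
    (forall (e : 'I_(be_ne X)) (i j : nat), (i < 2 ^ l)%N -> (j < 2 ^ l)%N ->
       sufficient (bernstein_coefs (8 * p - 2)%N (8 * q - 2)%N
         (subpatch l (i, j) (gram_num (patchF e) (patchW e))))) /\
    (forall Kmax : nat, (l <= Kmax)%N ->
       exists2 k : nat, (k <= l)%N & hierarchical_check X Kmax = (Valid, k)).
Proof.
have NP (e : 'I_(be_ne X)) :
    bidegree (8 * p - 2) (8 * q - 2) (gram_num (patchF e) (patchW e)).
  apply: bidegree_gram_num; first exact: bidegree_bform_vec.
  exact: bidegree_bform.
have /choice[l lP] := fun e : 'I_(be_ne X) =>
  subpatch_sufficient (NP e) (N_gt0 e).
have big e : (l e <= \max_e l e)%N by exact: leq_bigmax.
exists (\max_e l e); split => [e i j im jm|Kmax lK]; first exact: lP.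
apply: check_valid.
- by move=> k [e ij] /andP[/= im jm];
  exact: (subpatch_corners (NP e) (N_gt0 e)).
- by move=> [e ij] /andP[/= im jm]; exact: lP.
- by rewrite lK.
- by apply/allP => _ /mapP[e _ ->].
Qed.
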